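(* Let $(W,R,B)$ be a general frame whose underlying Kripke frame $(W,R)$ has finite diversity, and let $\Delta$ be the duplication relation of $(W,R)$. If $\{w\}\in B$ for every $w\in W$ and $D\in B$ for every $D\in W/\Delta$, then $B$ is a PQML-invariant subdomain of $\wp(W)$. (Of the closure properties of $B$ in the definition of a general frame, only closure under Boolean operations is used, i.e. closure of $B$ under $m_\Diamond$ is not needed.)
   Context: Language. Fix a countably infinite set $\mathsf{Prop}$ of propositional variables. $\mathcal{L}$ is given by $\varphi::=p\mid\neg\varphi\mid(\varphi\vee\varphi)\mid\Diamond\varphi\mid\exists p\,\varphi$ with $p\in\mathsf{Prop}$. A Kripke frame is a pair $(W,R)$ with $W\ne\varnothing$, $R\subseteq W^2$; put $m_\Diamond(X)=\{w\in W\mid\exists u\in X,\ wRu\}$. A general frame is $(W,R,B)$ with $(W,R)$ a Kripke frame and $B\subseteq\wp(W)$ non-empty and closed under Boolean operations and $m_\Diamond$. For a Kripke frame $(W,R)$, a non-empty $B\subseteq\wp(W)$ and a valuation $v:\mathsf{Prop}\to B$, define $[\![p]\!]^B(v)=v(p)$, $[\![\neg\varphi]\!]^B(v)=W\setminus[\![\varphi]\!]^B(v)$, $[\![\varphi\vee\psi]\!]^B(v)=[\![\varphi]\!]^B(v)\cup[\![\psi]\!]^B(v)$, $[\![\Diamond\varphi]\!]^B(v)=m_\Diamond([\![\varphi]\!]^B(v))$, $[\![\exists p\,\varphi]\!]^B(v)=\bigcup\{[\![\varphi]\!]^B(v[X/p])\mid X\in B\}$, where $v[X/p]$ agrees with $v$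 except that it sends $p$ to $X$. For non-empty $A,B\subseteq\wp(W)$, $A$ is a PQML-invariant subdomain of $B$ if $A\subseteq B$ and $[\![\varphi]\!]^A(v)=[\![\varphi]\!]^B(v)$ for all $\varphi\in\mathcal{L}$ and $v\in A^{\mathsf{Prop}}$. Worlds $w,u\in W$ are duplicates if the permutation of $W$ exchanging $w$ and $u$ (and fixing everything else) is an automorphism of $(W,R)$. This is an equivalence relation $\Delta$ on $W$ (the duplication relation); $W/\Delta$ is its set of equivalence classes, and the diversity of $(W,R)$ is the cardinality of $W/\Delta$. *)

(* Defs.v *)
From mathcomp Require Import all_boot.
From mathcomp Require Import boolp classical_sets functions cardinality.

Set Implicit Arguments.
Unset Strict Implicit.
Unset Printing Implicit Defensive.

Local Open Scope classical_set_scope.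

(* The countably infinite set of propositional variables is [nat]. *)
Inductive formula : Type :=
| Var of nat
| Neg of formula
| Or of formula & formula
| Dia of formula
| Ex of nat & formula.

Record kripke_frame : Type := KripkeFrame {
  world :> Type;
  acc : world -> world -> Prop;
  world_inhabited : inhabited world }.

Arguments acc {k}.

Definition dia (F : kripke_frame) (X : set F) : set F :=
  [set w | exists2 u, X u & acc w u].

Definition boolean_closed (T : Type) (B : set (set T)) : Prop :=
  [/\ forall X, B X -> B (~` X), setU_closed B & setI_closed B].

Definition general_frame (F : kripke_frame) (B : set (set F)) : Prop :=
  [/\ B !=set0, boolean_closed B & forall X, B X -> B (dia X)].

Definition update (T : Type) (v : nat -> T) (p : nat) (X : T) : nat -> T :=
  fun q => if q == p then X else v q.

(* [sem] is total on valuations in the full powerset; the requirement that [v]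
   take its values in [B] is imposed where [sem] is used. *)
Fixpoint sem (F : kripke_frame) (B : set (set F)) (phi : formula)
    (v : nat -> set F) : set F :=
  match phi with
  | Var p => v p
  | Neg phi1 => ~` sem B phi1 v
  | Or phi1 phi2 => sem B phi1 v `|` sem B phi2 v
  | Dia phi1 => dia (sem B phi1 v)
  | Ex p phi1 => \bigcup_(X in B) sem B phi1 (update v p X)
  end.

Definition pqml_invariant_subdomain (F : kripke_frame) (A B : set (set F)) :
    Prop :=
  [/\ A !=set0, B !=set0, A `<=` B &
      forall (phi : formula) (v : nat -> set F),
        (forall p, A (v p)) -> sem A phi v = sem B phi v].

Definition automorphism (F : kripke_frame) (f : F -> F) : Prop :=
  bijective f /\ forall x y, acc x y <-> acc (f x) (f y).

Definition exchange (T : Type) (w u x : T) : T :=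
  if `[< x = w >] then u else if `[< x = u >] then w else x.

Definition duplicate (F : kripke_frame) (w u : F) : Prop :=
  automorphism (exchange w u).

Definition duplicate_classes (F : kripke_frame) : set (set F) :=
  range (fun w : F => [set u | duplicate w u]).

Arguments duplicate_classes : clear implicits.

Definition finite_diversity (F : kripke_frame) : Prop :=
  finite_set (duplicate_classes F).

(* Main.v *)
Require Import Defs.
From mathcomp Require Import all_boot.
From mathcomp Require Import boolp classical_sets functions cardinality.

Set Implicit Arguments.
Unset Strict Implicit.
Unset Printing Implicit Defensive.

Local Open Scope classical_set_scope.

(** An Ehrenfeucht-Fraisse argument.  Colour the worlds with finitely many
    colours so that equally coloured worlds are duplicates and satisfy the same
    relevant variables.  Two colourings, one for each domain of quantification,
    are matched at level [n] if corresponding colour classes have the same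
    cardinality up to the threshold [n].  A witness [X] for a quantifier splits
    every colour class in two, and the split can be imitated on the other side
    at the price of halving the threshold.  The imitating set needs to contain
    or omit only finitely many points of each class, so it can be found in any
    Boolean algebra that contains the colour classes and the singletons. *)

(** * Cardinalities compared up to a threshold *)

Fixpoint atleast (T : Type) (n : nat) (X : set T) : Prop :=
  if n is m.+1 then exists2 x, X x & atleast m (X `\ x) else True.

Definition similar (T U : Type) (n : nat) (X : set T) (Y : set U) : Prop :=
  forall j, j <= n -> atleast j X <-> atleast j Y.

Lemma setD1C (T : Type) (X : set T) (x y : T) : X `\ x `\ y = X `\ y `\ x.
Proof. by rewrite !setDDl setUC. Qed.

(** Any point of [X] may be the first one removed: the recursion supplies some [y], and the removals
    of [x] and [y] commute. *)
Lemma atleast_setD1 (T : Type) (n : nat) (X : set T) (x : T) :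
  X x -> atleast n.+1 X <-> atleast n (X `\ x).
Proof.
move=> Xx; split; last by exists x.
elim: n => [//|n IH] in X x Xx *.
case=> y Xy Xy_n; have [xy|neq_xy] := pselect (x = y); first by rewrite xy.
exists y; first by split=> // /esym.
by rewrite setD1C; apply: IH.
Qed.

Lemma similar_set0 (T U : Type) (n : nat) : similar n (@set0 T) (@set0 U).
Proof. by move=> [|j] _; split=> [] // []. Qed.

Lemma similar_sym (T U : Type) (n : nat) (X : set T) (Y : set U) :
  similar n X Y -> similar n Y X.
Proof. by move=> XY j /XY[XYj YXj]; split. Qed.

Lemma similar_le (T U : Type) (m n : nat) (X : set T) (Y : set U) :
  m <= n -> similar n X Y -> similar m X Y.
Proof. by move=> mn XY j jm; apply: XY; apply: leq_trans mn. Qed.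

Lemma similar_setD1 (T U : Type) (n : nat) (X : set T) (Y : set U) x y :
  X x -> Y y -> similar n.+1 X Y <-> similar n (X `\ x) (Y `\ y).
Proof.
move=> Xx Yy; split=> XY.
  move=> j jn; rewrite -(propext (atleast_setD1 j Xx)).
  by rewrite -(propext (atleast_setD1 j Yy)); apply: XY.
case=> [//|j jn].
by rewrite (propext (atleast_setD1 j Xx)) (propext (atleast_setD1 j Yy)); apply: XY.
Qed.

Lemma similar_nonempty (T U : Type) (n : nat) (X : set T) (Y : set U) :
  similar n.+1 X Y -> Y !=set0 -> X !=set0.
Proof. by move=> XY [y Yy]; have [|x Xx _] := (XY 1 isT).2; [exists y|exists x]. Qed.

Lemma similar_other (T U : Type) (n : nat) (X : set T) (Y : set U) x x' y :
  similar n.+2 X Y -> X x -> X x' -> x <> x' -> exists2 z, Y z & z <> y.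
Proof.
move=> XY Xx Xx' xx'.
have [|z Yz [z' [Yz' zz'] _]] := (XY 2 isT).1.
  by exists x => //; exists x' => //; split=> // /esym.
by have [zy|] := pselect (z = y); [exists z'; rewrite // -zy|exists z].
Qed.

(** * Splitting sets inside a Boolean algebra with all singletons *)

Definition point_algebra (T : Type) (B : set (set T)) : Prop :=
  boolean_closed B /\ forall x, B [set x].

Section PointAlgebra.
Context {T : Type} {B : set (set T)} (hB : point_algebra B).

Lemma point_algebraC X : B X -> B (~` X).
Proof. by case: hB => -[+ _ _] _; apply. Qed.

Lemma point_algebraI X Y : B X -> B Y -> B (X `&` Y).
Proof. by case: hB => -[_ _ +] _; apply. Qed.

Lemma point_algebraU X Y : B X -> B Y -> B (X `|` Y).
Proof. by case: hB => -[_ + _] _; apply. Qed.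

Lemma point_algebraD X Y : B X -> B Y -> B (X `\` Y).
Proof. by move=> BX BY; apply: point_algebraI => //; apply: point_algebraC. Qed.

Lemma point_algebra1 x : B [set x].
Proof. by case: hB. Qed.

Lemma point_algebra0 : inhabited T -> B set0.
Proof.
by case=> x; rewrite -(setDv [set x]); apply: point_algebraD;
  apply: point_algebra1.
Qed.

(** Only finite unions stay in [B], hence the list [s]. Since each [f i] lies in the fibre of [i],
    the union of the pieces is found by testing [x] against the piece of its own colour. *)
Lemma point_algebra_bigU (I : eqType) (c : T -> I) (f : I -> set T) (s : seq I) :
  inhabited T -> (forall i, B (f i)) -> (forall i, f i `<=` c @^-1` [set i]) ->
  B [set x | c x \in s /\ f (c x) x].
Proof.
move=> T0 Bf fc; elim: s => [|i s IH].
  rewrite (_ : mkset _ = set0); first exact: point_algebra0.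
  by rewrite predeqE => x; split=> // -[].
rewrite (_ : mkset _ = f i `|` [set x | c x \in s /\ f (c x) x]).
  exact: point_algebraU.
rewrite predeqE => x; split=> /=.
  by rewrite in_cons => -[/orP[/eqP->|? ?]]; [left|right].
case=> [fix_|[cs fx]]; last by rewrite in_cons cs orbT.
by rewrite (fc _ _ fix_) mem_head.
Qed.

(* Remove a pair of points, one from [C] and one from either [Y] or [C' `\` Y],
   until one of these two sets is empty or both thresholds are used up. *)
Lemma similar_split (U : Type) (a b : nat) (C : set T) (C' Y : set U) :
  inhabited T -> B C -> similar (a + b) C C' -> Y `<=` C' ->
  exists X, [/\ B X, X `<=` C, similar a X Y & similar b (C `\` X) (C' `\` Y)].
Proof.
move=> T0; move en : (a + b) => n.
elim: n => [|n IH] in a b en C C' Y *.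
  move: en; case: a b => [|//] [|//] _ BC _ _.
  by exists set0; split; [exact: point_algebra0| |case|case].
move=> BC CC' YC'.
have [Y0|/set0P [y Yy]] := eqVneq Y set0.
  exists set0; rewrite Y0 !setD0; split=> //; first exact: point_algebra0.
    exact: similar_set0.
  by apply: similar_le CC'; rewrite -en leq_addl.
have [D0|/set0P [z [C'z Yz]]] := eqVneq (C' `\` Y) set0.
  have -> : Y = C' by rewrite eqEsubset; split=> //; rewrite -setD_eq0.
  exists C; rewrite !setDv; split=> //.
    by apply: similar_le CC'; rewrite -en leq_addr.
  exact: similar_set0.
have [x Cx] : C !=set0 by apply: (similar_nonempty CC'); exists y; apply: YC'.
have BCx : B (C `\ x) by apply: point_algebraD => //; apply: point_algebra1.
(* While [a] is positive, the pair is [x] and [y], and [x] joins the imitating set. Once [a] is 0,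
   the pair is [x] and [z], taken from the two complements. *)
case: a en => [|a] en; last first.
  have [||||X [BX XC XY XYc]] := IH a b _ (C `\ x) (C' `\ y) (Y `\ y) => //.
  - by case: en.
  - by apply/similar_setD1 => //; apply: YC'.
  - exact: setSD.
  have Xx : ~ X x by move=> /XC[_]; apply.
  exists (x |` X); split.
  - by apply: point_algebraU => //; apply: point_algebra1.
  - by move=> u [->|/XC[]].
  - apply/(@similar_setD1 _ _ _ _ _ x y) => //; first by left.
    rewrite (_ : (x |` X) `\ x = X) // predeqE => u; split=> [[[]]|Xu] //.
    by split; [right|move=> ux; apply: Xx; rewrite -ux].
  - rewrite -setDDl; rewrite (_ : C' `\` Y = C' `\ y `\` (Y `\ y)) //.
    rewrite predeqE => u; split=> [[C'u Yu]|[[C'u uy] Yu]].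
      by split; [split=> // uy; apply: Yu; rewrite uy|case].
    by split=> // Yu'; apply: Yu.
case: b en => [//|b] en.
have [||||X [BX XC XY XYc]] := IH 0 b _ (C `\ x) (C' `\ z) Y => //.
- by case: en.
- exact/similar_setD1.
- by move=> u Yu; split; [exact: YC'|move=> uz; apply: Yz; rewrite -uz].
exists X; split=> //; first by move=> u /XC[].
apply/(@similar_setD1 _ _ _ _ _ x z) => //.
  by split=> // /XC[_]; apply.
by rewrite !setDDl !(setUC _ [set _]) -!setDDl.
Qed.

End PointAlgebra.

(** * Refinements of colourings *)

Definition refine (T I : Type) (c : T -> I) (X : set T) (x : T) : I * bool :=
  (c x, `[< X x >]).

Lemma refine_fiber (T I : Type) (c : T -> I) (X : set T) i b :
  refine c X @^-1` [set (i, b)] =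
    if b then c @^-1` [set i] `&` X else c @^-1` [set i] `\` X.
Proof.
rewrite predeqE => x; rewrite /refine /=; case: b; split=> /=.
- by case=> -> /asboolP.
- by case=> -> /asboolP ->.
- by case=> -> /asboolPn.
- by case=> -> /asboolPn /negbTE ->.
Qed.

Lemma refine_measurable (T I : Type) (B : set (set T)) (c : T -> I) (X : set T) :
  point_algebra B -> (forall i, B (c @^-1` [set i])) -> B X ->
  forall i, B (refine c X @^-1` [set i]).
Proof.
move=> hB Bc BX [i b]; rewrite refine_fiber.
by case: b; [apply: point_algebraI|apply: point_algebraD].
Qed.

(** The threshold [n + n] pays for both halves of each class, inside and outside [Y]. The sets
    chosen class by class glue to a member of [B] because there are finitely many colours. *)
Lemma refine_similar (T U : Type) (B : set (set T)) (I : finType)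
    (c : T -> I) (c' : U -> I) (Y : set U) (n : nat) :
  inhabited T -> point_algebra B -> (forall i, B (c @^-1` [set i])) ->
  (forall i, similar (n + n) (c @^-1` [set i]) (c' @^-1` [set i])) ->
  exists2 X, B X & forall i,
    similar n (refine c X @^-1` [set i]) (refine c' Y @^-1` [set i]).
Proof.
move=> T0 hB Bc cc'.
have /choice[f hf] i := similar_split hB T0 (Bc i) (cc' i) (@subIsetl _ _ Y).
have fc i : f i `<=` c @^-1` [set i] by case: (hf i).
exists [set x | c x \in enum I /\ f (c x) x].
  by apply: (@point_algebra_bigU _ _ hB _ c) => // i; case: (hf i).
move=> [i b]; rewrite !refine_fiber.
have -> : c @^-1` [set i] `&` [set x | c x \in enum I /\ f (c x) x] = f i.
  rewrite predeqE => x; split=> /= [[-> []]//|fx].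
  by have /= cx := fc _ _ fx; rewrite cx mem_enum.
have -> : c @^-1` [set i] `\` [set x | c x \in enum I /\ f (c x) x] =
    c @^-1` [set i] `\` f i.
  rewrite predeqE => x; split=> /= -[cx]; rewrite cx; last first.
    by move=> fx; split=> // -[].
  by move=> fx; split=> // ?; apply: fx; rewrite mem_enum.
have [_ _] := hf i; rewrite setDIr setDv set0U.
by case: b.
Qed.

(** Taking one point out of each of two corresponding classes costs one unit of the threshold; the
    classes of other colours do not change. *)
Lemma refine_point_similar (T U I : Type) (c : T -> I) (c' : U -> I) (n : nat) x y :
  (forall i, similar n.+1 (c @^-1` [set i]) (c' @^-1` [set i])) -> c x = c' y ->
  forall i,
    similar n (refine c [set x] @^-1` [set i]) (refine c' [set y] @^-1` [set i]).
Proof.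
move=> cc' cxy [i b]; rewrite !refine_fiber.
have [cxi|cxi] := pselect (c x = i).
  have cyi : c' y = i by rewrite -cxy.
  case: b; last exact/similar_setD1.
  apply: similar_le (leqnSn n) _.
  apply/(@similar_setD1 _ _ _ _ _ x y) => //.
  by rewrite -!setIDA !setDv !setI0; apply: similar_set0.
have cyi : c' y <> i by rewrite -cxy.
case: b; last first.
  by rewrite !not_setD1 //; apply: similar_le (leqnSn n) _.
by rewrite !setI1 !memNset //; apply: similar_set0.
Qed.

(** The colour of a point is the vector of its membership bits in the sets of [s], so each fibre is
    a finite Boolean combination of them. *)
Lemma exists_separating_coloring (T : Type) (B : set (set T)) (s : seq (set T)) :
  inhabited T -> point_algebra B -> (forall X, X \in s -> B X) ->
  exists (I : finType) (c : T -> I), (forall i, B (c @^-1` [set i])) /\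
    forall x y, c x = c y -> forall X, X \in s -> X x <-> X y.
Proof.
move=> T0 hB; elim: s => [_|Y s IH Bs].
  exists unit, (fun=> tt); split=> // -[].
  rewrite (_ : _ @^-1` _ = ~` set0); last by rewrite setC0; apply/seteqP.
  by apply: point_algebraC => //; apply: point_algebra0.
have [|I [c [Bc cs]]] := IH.
  by move=> X Xs; apply: Bs; rewrite in_cons Xs orbT.
exists (I * bool)%type, (refine c Y); split.
  by apply: refine_measurable => //; apply: Bs; rewrite mem_head.
move=> x y [cxy Yxy] X; rewrite in_cons => /orP[/eqP->|]; last exact: cs.
exact: asbool_eq_equiv.
Qed.

(** * Moving edges along duplicates *)

Lemma exchangeL (T : Type) (w u : T) : exchange w u w = u.
Proof. by rewrite /exchange asboolT. Qed.

Lemma exchangeR (T : Type) (w u : T) : exchange w u u = w.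
Proof. by rewrite /exchange (asboolT (erefl u)); case: asboolP. Qed.

Lemma exchange_id (T : Type) (w u x : T) : x <> w -> x <> u -> exchange w u x = x.
Proof. by move=> xw xu; rewrite /exchange !asboolF. Qed.

Lemma exchangeC (T : Type) (w u : T) : exchange w u = exchange u w.
Proof.
by apply/funext => x; rewrite /exchange; do 2![case: asboolP => //]; move=> <-.
Qed.

Lemma duplicate_sym (F : kripke_frame) (w u : F) : duplicate w u -> duplicate u w.
Proof. by rewrite /duplicate exchangeC. Qed.

Lemma duplicate_refl (F : kripke_frame) (w : F) : duplicate w w.
Proof.
rewrite /duplicate (_ : exchange w w = id); last first.
  by apply/funext => x; rewrite /exchange; do 2![case: asboolP => //].
by split=> //; exists id.
Qed.

Lemma duplicate_acc_refl (F : kripke_frame) (w w' : F) :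
  duplicate w w' -> acc w w -> acc w' w'.
Proof. by case=> _ h /h; rewrite exchangeL. Qed.

Lemma duplicate_accl (F : kripke_frame) (w w' u : F) :
  duplicate w w' -> u <> w -> u <> w' -> acc w u -> acc w' u.
Proof. by case=> _ h uw uw' /h; rewrite exchangeL exchange_id. Qed.

Lemma duplicate_accr (F : kripke_frame) (w u u' : F) :
  duplicate u u' -> w <> u -> w <> u' -> acc w u -> acc w u'.
Proof. by case=> _ h wu wu' /h; rewrite exchangeL exchange_id. Qed.

(** The endpoints are moved one at a time, through the pair [w', u] or, if [u = w'], through
    [w, u']. When also [w = u'], a single exchange reverses the edge. *)
Lemma duplicate_acc (F : kripke_frame) (w w' u u' : F) :
  duplicate w w' -> duplicate u u' -> w <> u -> w' <> u' -> acc w u -> acc w' u'.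
Proof.
move=> ww' uu' wu w'u' Rwu.
have [uw'|uw'] := pselect (u = w'); last first.
  apply: (duplicate_accr uu') => //; first exact/nesym.
  by apply: duplicate_accl Rwu => //; apply/nesym.
subst u; have [<-|wu'] := pselect (w = u').
  by case: ww' Rwu => _ h /h; rewrite exchangeL exchangeR.
apply: (duplicate_accl ww'); [exact/nesym|exact/nesym|].
exact: (duplicate_accr uu').
Qed.

(** * The back-and-forth induction on formulas *)

Fixpoint vars (phi : formula) : seq nat :=
  match phi with
  | Var p => [:: p]
  | Neg phi1 => vars phi1
  | Or phi1 phi2 => vars phi1 ++ vars phi2
  | Dia phi1 => vars phi1
  | Ex _ phi1 => vars phi1
  end.

(** At [Dia] two units are needed to see a second point in the class of the current world. At [Ex]
    one unit isolates the current world and the rest is halved by the split; the inner successors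
    leave a positive threshold, so that nonempty refined classes have nonempty counterparts. *)
Fixpoint threshold (phi : formula) : nat :=
  match phi with
  | Var _ => 1
  | Neg phi1 => threshold phi1
  | Or phi1 phi2 => maxn (threshold phi1) (threshold phi2)
  | Dia phi1 => (threshold phi1).+2
  | Ex _ phi1 => ((threshold phi1).+1 + (threshold phi1).+1).+1
  end.

Definition matched (F : kripke_frame) (B B' : set (set F)) (I : finType)
    (c c' : F -> I) (n : nat) : Prop :=
  [/\ forall i, B (c @^-1` [set i]), forall i, B' (c' @^-1` [set i]),
      forall i, similar n (c @^-1` [set i]) (c' @^-1` [set i]) &
      forall x y, c x = c' y -> duplicate x y].

Definition agree (F : kripke_frame) (I : Type) (c c' : F -> I) (s : seq nat)
    (v v' : nat -> set F) : Prop :=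
  forall x y, c x = c' y -> forall p, p \in s -> v p x <-> v' p y.

Lemma matched_sym (F : kripke_frame) (B B' : set (set F)) (I : finType)
    (c c' : F -> I) n : matched B B' c c' n -> matched B' B c' c n.
Proof.
case=> Bc Bc' cc' dup; split=> // [i|x y cxy]; first exact: similar_sym.
by apply: duplicate_sym; apply: dup.
Qed.

Lemma matched_le (F : kripke_frame) (B B' : set (set F)) (I : finType)
    (c c' : F -> I) m n : m <= n -> matched B B' c c' n -> matched B B' c c' m.
Proof. by move=> mn [Bc Bc' cc' dup]; split=> // i; apply: similar_le (cc' i). Qed.

Lemma agree_sym (F : kripke_frame) (I : Type) (c c' : F -> I) s v v' :
  agree c c' s v v' -> agree c' c s v' v.
Proof. by move=> cc' x y cxy p ps; split=> /cc'; apply. Qed.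

Lemma agree_sub (F : kripke_frame) (I : Type) (c c' : F -> I) s s' v v' :
  {subset s <= s'} -> agree c c' s' v v' -> agree c c' s v v'.
Proof. by move=> ss' cc' x y cxy p /ss'; apply: cc'. Qed.

Lemma agree_refine (F : kripke_frame) (I : Type) (c c' : F -> I) s v v' p X Y :
  agree c c' s v v' ->
  agree (refine c X) (refine c' Y) s (update v p X) (update v' p Y).
Proof.
move=> cc' x y [cxy XY] q qs; rewrite /update.
by case: ifP => _; [apply: asbool_eq_equiv|apply: cc'].
Qed.

(** Duplicates carry loops to loops and edges between distinct worlds to such edges. So [z] is [y]
    itself for a loop, and otherwise must avoid [y], which takes a second point if [x] and [u] share
    a colour. *)
Lemma matched_dia (F : kripke_frame) (B B' : set (set F)) (I : finType)
    (c c' : F -> I) n (x y u : F) :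
  matched B B' c c' n.+2 -> c x = c' y -> acc x u ->
  exists2 z, c u = c' z & acc y z.
Proof.
move=> [_ _ cc' dup] cxy Rxu; have [xu|xu] := pselect (x = u).
  by subst u; exists y => //; apply: duplicate_acc_refl Rxu; apply: dup.
suff [z cz /nesym yz] : exists2 z, c' z = c u & z <> y.
  by exists z => //; apply: duplicate_acc Rxu => //; apply: dup.
have [cxu|cxu] := pselect (c x = c u).
  by apply: (similar_other y (cc' (c u)) cxu _ xu).
have [|z cz] := similar_nonempty (similar_sym (cc' (c u))); first by exists u.
by exists z => // zy; apply: cxu; rewrite cxy -zy.
Qed.

(** Domains, colourings and valuations all vary in the induction: negation exchanges the two sides,
    and a quantifier refines the colourings. By this symmetry one implication is enough. *)
Lemma sem_matched (F : kripke_frame) (phi : formula) (B B' : set (set F))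
    (I : finType) (c c' : F -> I) (v v' : nat -> set F) (x y : F) :
  point_algebra B -> point_algebra B' ->
  matched B B' c c' (threshold phi) -> agree c c' (vars phi) v v' ->
  c x = c' y -> sem B phi v x -> sem B' phi v' y.
Proof.
elim: phi => [p|phi IH|phi1 IH1 phi2 IH2|phi IH|p phi IH] /=
  in B B' I c c' v v' x y *; move=> hB hB' m a cxy.
- by apply: (a _ _ cxy p _).1; rewrite mem_head.
- apply: contra_not; apply: IH (esym cxy) => //.
    exact: matched_sym.
  exact: agree_sym.
- case=> [h|h].
    left; apply: (IH1 B B' I c c') h => //.
      by apply: matched_le m; rewrite leq_maxl.
    by apply: agree_sub a => q qs; rewrite mem_cat qs.
  right; apply: (IH2 B B' I c c') h => //.
    by apply: matched_le m; rewrite leq_maxr.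
  by apply: agree_sub a => q qs; rewrite mem_cat qs orbT.
- case=> u phi_u Rxu; have [z cuz Ryz] := matched_dia m cxy Rxu.
  exists z => //; apply: IH a cuz phi_u => //.
  by apply: matched_le m; rewrite -addn2 leq_addr.
- case=> X BX phi_x; case: m => Bc Bc' cc' dup.
  (* Colouring [x] and [y] specially forces [y] into the part of its class
     that corresponds to the part containing [x]. *)
  set d := refine c [set x]; set d' := refine c' [set y].
  have Bd : forall i, B (d @^-1` [set i]).
    by apply: refine_measurable => //; apply: point_algebra1.
  have Bd' : forall i, B' (d' @^-1` [set i]).
    by apply: refine_measurable => //; apply: point_algebra1.
  have dd' := refine_point_similar cc' cxy.
  (* The witness [X] lives on the side of [B], so the imitation takes place in [B'] and the
     similarity is reversed. *)
  have [Y B'Y YX] := refine_similar X (world_inhabited F) hB' Bd'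
    (fun i => similar_sym (dd' i)).
  (* The refined class of [x] has a nonempty counterpart, and its mark from [[set x]] leaves [y] as
     the only possible member. *)
  have ex : refine d X x = refine d' Y y.
    have [] := similar_nonempty (YX (refine d X x)); first by exists x.
    move=> z dz; suff zy : z = y by rewrite -[in RHS]zy -dz.
    case: (dz : refine (refine c' [set y]) Y z = refine (refine c [set x]) X x).
    by move=> _ zy _; apply: (asbool_eq_equiv zy).2.
  exists Y => //; apply: (IH B B' _ (refine d X) (refine d' Y)) phi_x => //.
  + split=> [||i|z t [/dup]//]; try exact: refine_measurable.
    by apply: similar_le (similar_sym (YX i)).
  + by apply: agree_refine => z t [/a].
Qed.

Unset Implicit Arguments.

(* The second conjunct drops closure under [dia], keeping only the Boolean
   closure of the non-empty family [B]. *)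
Theorem theorem4p11 (F : kripke_frame) (B : set (set F))
    (hfin : finite_diversity F)
    (hsingle : forall w : F, B [set w])
    (hclass : forall D : set F, duplicate_classes F D -> B D) :
  (general_frame B -> pqml_invariant_subdomain B [set: set F]) /\
  (B !=set0 -> boolean_closed B -> pqml_invariant_subdomain B [set: set F]).
Proof.
suff main : B !=set0 -> boolean_closed B -> pqml_invariant_subdomain B [set: set F].
  by split=> // -[B0 clB _]; apply: main.
move=> B0 clB; have hB : point_algebra B by split.
have hT : point_algebra [set: set F] by split.
split=> // [|phi v Bv]; first by exists set0.
have /finite_seqP[classes classesE] := hfin.
(* Finite diversity makes this a finite list: the duplication classes together with the values of
   the relevant variables. *)
have [|I [c [Bc cs]]] :=
    @exists_separating_coloring _ B (classes ++ map v (vars phi))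
      (world_inhabited F) hB.
  move=> X; rewrite mem_cat => /orP[XD|/mapP[p _ ->] //].
  by apply: hclass; rewrite classesE.
(* With the same colouring on both sides, similarity holds at every threshold, and equal colours
   mean equal duplication classes. *)
have m (B1 B2 : set (set F)) n : (forall i, B1 (c @^-1` [set i])) ->
    (forall i, B2 (c @^-1` [set i])) -> matched B1 B2 c c n.
  move=> B1c B2c; split=> // x y cxy.
  apply: (cs _ _ cxy [set u | duplicate x u] _).1; last exact: duplicate_refl.
  have : duplicate_classes F [set u | duplicate x u] by exists x.
  by rewrite classesE mem_cat => ->.
have a : agree c c (vars phi) v v.
  by move=> x y cxy p pphi; apply: cs cxy _ _; rewrite mem_cat map_f // orbT.
by rewrite predeqE => x; split; apply: sem_matched a (erefl (c x)) => //; apply: m.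
Qed.
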